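(* Let $G$ be a finite simple graph. Then there is a monomial order $<$ on $T=S[y_1,\dots,y_m]$ such that the reduced Gröbner basis of $J$ with respect to $<$ consists of binomials of the form $f=u\,y_{i_1}\cdots y_{i_k}-v\,y_{j_1}\cdots y_{j_k}$, where $u$ and $v$ are monomials in $S$ of degree at most $2$.
   Context: Let $K$ be a field, let $G$ be a finite simple graph with vertex set $V(G)=[n]=\{1,\dots,n\}$ and edge set $E(G)=\{e_1,\dots,e_m\}$, and let $S=K[x_1,\dots,x_n]$ be the polynomial ring. For each $i$, write $e_i=\{p,q\}$ and put $u_i=(x_1\cdots x_n)/(x_px_q)$. The complementary edge ideal of $G$ is $I_c(G)=(u_1,\dots,u_m)\subset S$, and its Rees algebra is $\mathcal{R}(I_c(G))=\bigoplus_{k\ge 0}I_c(G)^kt^k\subset S[t]$. Let $T=S[y_1,\dots,y_m]=K[x_1,\dots,x_n,y_1,\dots,y_m]$, let $\varphi:T\to\mathcal{R}(I_c(G))$ be the $S$-algebra homomorphism with $\varphi(y_i)=u_it$ for $i=1,\dots,m$, and let $J=\ker\varphi$ (the defining ideal of the Rees algebra). *)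

(* Defs.v *)
From HB Require Import structures.
From mathcomp Require Import all_boot all_order all_algebra.
From mathcomp Require Export mpoly.

Set Implicit Arguments.
Unset Strict Implicit.
Unset Printing Implicit Defensive.

Import GRing.Theory.
Local Open Scope ring_scope.

Definition simple_graph (n : nat) (g : rel 'I_n) : Prop :=
  ssrbool.symmetric g /\ irreflexive g.

Definition edge_set (n : nat) (g : rel 'I_n) : {set {set 'I_n}} :=
  [set [set p.1; p.2] | p : 'I_n * 'I_n & g p.1 p.2].

Section Ideals.
Variable R : comNzRingType.

Definition ideal_span (A : R -> Prop) (p : R) : Prop :=
  exists (k : nat) (c a : 'I_k -> R),
    (forall i, A (a i)) /\ p = \sum_(i < k) c i * a i.

Fixpoint ideal_pow (I : R -> Prop) (k : nat) : R -> Prop :=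
  if k is k'.+1 then
    ideal_span (fun p => exists a b, [/\ I a, ideal_pow I k' b & p = a * b])
  else fun=> True.

Definition rees_algebra (I : R -> Prop) (p : {poly R}) : Prop :=
  forall k, ideal_pow I k p`_k.

Lemma ideal_span_gen (A : R -> Prop) a : A a -> ideal_span A a.
Proof.
move=> Aa; exists 1%N, (fun=> 1), (fun=> a); split=> //.
by rewrite big_ord1 mul1r.
Qed.

Lemma ideal_span0 (A : R -> Prop) : ideal_span A 0.
Proof.
by exists 0%N, (fun=> 0), (fun=> 0); split=> [[]//|]; rewrite big_ord0.
Qed.

Lemma ideal_spanD (A : R -> Prop) p q :
  ideal_span A p -> ideal_span A q -> ideal_span A (p + q).
Proof.
move=> [k [c [a [Aa ->]]]] [l [d [b [Ab ->]]]].
exists (k + l)%N,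
  (fun i => match split i with inl j => c j | inr j => d j end),
  (fun i => match split i with inl j => a j | inr j => b j end).
split=> [i|]; first by case: split.
rewrite big_split_ord; congr (_ + _); apply: eq_bigr => i _.
  by rewrite (unsplitK (inl i)).
by rewrite (unsplitK (inr i)).
Qed.

Lemma ideal_spanM (A : R -> Prop) r p : ideal_span A p -> ideal_span A (r * p).
Proof.
move=> [k [c [a [Aa ->]]]]; exists k, (fun i => r * c i), a; split=> //.
by rewrite mulr_sumr; apply: eq_bigr => i _; rewrite mulrA.
Qed.

Lemma ideal_span_sum (A : R -> Prop) (T : Type) (s : seq T) (F : T -> R) :
  (forall i, ideal_span A (F i)) -> ideal_span A (\sum_(i <- s) F i).
Proof.
by move=> AF; elim/big_ind: _ => //; [apply: ideal_span0 | apply: ideal_spanD].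
Qed.

Lemma ideal_pow0 I k : ideal_pow I k 0.
Proof. by case: k => //= k; apply: ideal_span0. Qed.

Lemma ideal_powD I k p q :
  ideal_pow I k p -> ideal_pow I k q -> ideal_pow I k (p + q).
Proof. by case: k => //= k; apply: ideal_spanD. Qed.

Lemma ideal_powMl I k r p : ideal_pow I k p -> ideal_pow I k (r * p).
Proof. by case: k => //= k; apply: ideal_spanM. Qed.

Lemma ideal_powM I j k p q :
  ideal_pow I j p -> ideal_pow I k q -> ideal_pow I (j + k) (p * q).
Proof.
elim: j p => [|j IHj] p; first by move=> _; apply: ideal_powMl.
move=> [l [c [a [Aa ->]]]] Iq; rewrite mulr_suml; apply: ideal_span_sum => i.
rewrite -mulrA; apply: ideal_spanM; apply: ideal_span_gen.
have [x [y [Ix Iy ->]]] := Aa i.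
by exists x, (y * q); split=> //; [apply: IHj | rewrite mulrA].
Qed.

Lemma rees_algebraC I r : rees_algebra I r%:P.
Proof. by case=> [|k]; rewrite coefC //; apply: ideal_pow0. Qed.

Lemma rees_algebraX I r : I r -> rees_algebra I (r%:P * 'X).
Proof.
move=> Ir [|[|k]]; rewrite coefMX coefC //=; last exact: ideal_span0.
apply: ideal_span_gen; exists r, 1.
by rewrite mulr1.
Qed.

Lemma rees_algebraD I p q :
  rees_algebra I p -> rees_algebra I q -> rees_algebra I (p + q).
Proof. by move=> Ip Iq k; rewrite coefD; apply: ideal_powD. Qed.

Lemma rees_algebraM I p q :
  rees_algebra I p -> rees_algebra I q -> rees_algebra I (p * q).
Proof.
move=> Ip Iq k; rewrite coefM; elim/big_ind: _ => [|x y|i _].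
- exact: ideal_pow0.
- exact: ideal_powD.
- by have := ideal_powM (Ip i) (Iq (k - i)%N); rewrite subnKC // -ltnS.
Qed.

End Ideals.

Section ComplementaryEdgeIdeal.
Variables (K : fieldType) (n m : nat) (e : 'I_m -> {set 'I_n}).

(* (x_1 ... x_n) / (x_p x_q) for e i = {p, q}.  Subtraction of monomials is
   truncated, but here it is exact because the exponents of x_p x_q are at
   most 1. *)
Definition comp_edge_gen (i : 'I_m) : {mpoly K[n]} :=
  'X_[[multinom 1%N | j < n] - [multinom (j \in e i : nat) | j < n]].

Definition comp_edge_ideal : {mpoly K[n]} -> Prop :=
  ideal_span (fun p => exists i, p = comp_edge_gen i).

(* T = K[x_1..x_n, y_1..y_m] is {mpoly K[n + m]}: the first n variables are the
   x_j and the last m are the y_i.  S[t] is {poly {mpoly K[n]}}. *)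
Definition xvar (j : 'I_n) : {mpoly K[n + m]} := 'X_(lshift m j).
Definition yvar (i : 'I_m) : {mpoly K[n + m]} := 'X_(rshift n i).

Definition S_to_T (p : {mpoly K[n]}) : {mpoly K[n + m]} :=
  p \mPo [tuple xvar j | j < n].

Definition rees_map (p : {mpoly K[n + m]}) : {poly {mpoly K[n]}} :=
  mmap (polyC \o @mpolyC n K)
    (fun k => match split k with
              | inl j => ('X_j)%:P
              | inr i => (comp_edge_gen i)%:P * 'X
              end) p.

Definition rees_defining_ideal (p : {mpoly K[n + m]}) : Prop :=
  rees_map p = 0.

(* The kernel is unchanged by enlarging the codomain from the Rees algebra to
   S[t]. *)
Lemma rees_map_rees_algebra p : rees_algebra comp_edge_ideal (rees_map p).
Proof.
rewrite /rees_map /mmap; elim/big_ind: _ => [|x y|a _].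
- exact: (rees_algebraC _ 0).
- exact: rees_algebraD.
apply: rees_algebraM; first exact: rees_algebraC.
rewrite /mmap1; elim/big_ind: _ => [|x y|k _].
- exact: (rees_algebraC _ 1).
- exact: rees_algebraM.
elim: (a k) => [|d IHd]; first by rewrite expr0; exact: (rees_algebraC _ 1).
rewrite exprS; apply: rees_algebraM => //.
case: split => [j|i]; first exact: rees_algebraC.
by apply: rees_algebraX; apply: ideal_span_gen; exists i.
Qed.

Lemma rees_map_S_to_T p : rees_map (S_to_T p) = p%:P.
Proof.
rewrite /S_to_T comp_mpolyE /rees_map raddf_sum /= [in RHS](mpolyE p) raddf_sum.
apply: eq_bigr => a _; rewrite -mul_mpolyC rmorphM /= mmapC /=.
rewrite -mul_mpolyC polyCM; congr (_ * _).
rewrite mpolyXE_id !rmorph_prod /=; apply: eq_bigr => j _.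
rewrite tnth_mktuple !rmorphXn /= mmapX mmap1U.
by rewrite (unsplitK (inl j)).
Qed.

Lemma rees_map_yvar i : rees_map (yvar i) = (comp_edge_gen i)%:P * 'X.
Proof. by rewrite /rees_map mmapX mmap1U (unsplitK (inr i)). Qed.

End ComplementaryEdgeIdeal.

Section Groebner.
Variables (K : fieldType) (N : nat).

Definition monomial_order (le : rel 'X_{1..N}) : Prop :=
  [/\ reflexive le, antisymmetric le, transitive le & total le] /\
  [/\ forall a : 'X_{1..N}, le 0%MM a
    & forall a b c : 'X_{1..N}, le a b -> le (a + c)%MM (b + c)%MM].

(* For a monomial order, 0%MM is the least monomial, so this is the largest
   element of msupp p when p != 0. *)
Definition init_mon (le : rel 'X_{1..N}) (p : {mpoly K[N]}) : 'X_{1..N} :=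
  foldr (fun a b => if le a b then b else a) 0%MM (msupp p).

Lemma init_monP (le : rel 'X_{1..N}) (p : {mpoly K[N]}) :
  monomial_order le -> p != 0 ->
  init_mon le p \in msupp p /\
  forall a, a \in msupp p -> le a (init_mon le p).
Proof.
move=> [[le_refl le_anti le_trans le_total] [le0 _]].
rewrite -msupp_eq0 /init_mon; elim: (msupp p) => // a s IHs _ /=.
have [-> | s_neq0] := eqVneq s [::].
  rewrite /=; case: ifP => [lea0|_]; last first.
    by rewrite mem_head; split=> // b; rewrite inE => /eqP->.
  have -> : a = 0%MM by apply: le_anti; rewrite lea0 le0.
  by rewrite mem_head; split=> // b; rewrite inE => /eqP->.
have [s_in s_max] := IHs s_neq0; set b := foldr _ _ _ in s_in s_max *.
case: ifP => [leab | nleab]; split.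
- by rewrite inE s_in orbT.
- by move=> c; rewrite inE => /predU1P[-> // | /s_max].
- exact: mem_head.
move=> c; rewrite inE => /predU1P[-> // | /s_max lecb].
by apply: le_trans lecb _; have := le_total a b; rewrite nleab.
Qed.

Definition init_ideal (le : rel 'X_{1..N}) (A : {mpoly K[N]} -> Prop) :
    {mpoly K[N]} -> Prop :=
  ideal_span (fun q => exists p, [/\ A p, p != 0 & q = 'X_[init_mon le p]]).

Definition groebner_basis (le : rel 'X_{1..N}) (J : {mpoly K[N]} -> Prop)
    (B : seq {mpoly K[N]}) : Prop :=
  (forall f, f \in B -> J f /\ f != 0) /\
  (forall q, init_ideal le J q <-> init_ideal le (fun f => f \in B) q).

Definition reduced_groebner_basis (le : rel 'X_{1..N})
    (J : {mpoly K[N]} -> Prop) (B : seq {mpoly K[N]}) : Prop :=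
  [/\ groebner_basis le J B,
      forall f, f \in B -> f@_(init_mon le f) = 1
    & forall f g, f \in B -> g \in B -> f != g ->
        forall a, a \in msupp g -> ~~ (init_mon le f <= a)%MM].

End Groebner.

(* Main.v *)
Require Import Defs.
From mathcomp Require Import all_boot all_order all_algebra.
From Stdlib Require Import Classical.

(** Every monomial order works; the proof uses the degree lexicographic one.

    The ideal J is toric: the map to S[t] sends monomials to monomials, so J is
    spanned by the differences of two monomials with the same image.  Call the
    set of monomials with a given image a fibre, and its least element standard.
    The initial monomials of J are the nonstandard monomials ([mlead_nonstd]),
    so the reduced Groebner basis consists of the binomials X^a - X^b where a is
    a minimal nonstandard monomial and b the least element of its fibre
    ([toric_reduced_groebner_basis]); there are finitely many of them by
    Dickson's lemma ([finite_antichain]).  Such a binomial is primitive: if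
    a' | a and b' | b are distinct with the same image, then a' = a
    ([min_nonstd_primitive]).  Otherwise a' would be standard, as is b', being a
    divisor of the standard b; but a fibre has only one standard monomial.

    It remains to bound the x-degree of a primitive binomial
    x^u y^a - x^v y^b.  Multiplying out the denominators x_p x_q of the u_i,
    equality of the images says that |a| = |b| and
        x^u * (product of the edges of b) = x^v * (product of the edges of a).
    Read a and b as two multisets of edges, coloured red and blue, and u and v
    as blue and red half-edges.  Then each vertex has as many red as blue
    incidences, so an alternating path that starts with a half-edge can be
    continued until it reaches another half-edge ([alternating_path]).  A path
    joining a half-edge of u to one of v has as many red as blue edges.  A path
    joining two half-edges of u has one red edge more, and it can be combined
    with a path joining two half-edges of v.  Both give a binomial of J that
    divides the given one and has x-degree 1 or 2 ([small_balanced_part]), so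
    by primitivity the given one has x-degree at most 2. *)

Set Implicit Arguments.
Unset Strict Implicit.
Unset Printing Implicit Defensive.

Import Order.Theory GRing.Theory.
Local Open Scope ring_scope.

(** * The degree lexicographic order and Dickson's lemma *)

Lemma deglex_monomial_order (N : nat) :
  monomial_order (fun a b : 'X_{1..N} => (a <= b)%O).
Proof.
split; split.
- exact: lexx.
- exact: le_anti.
- exact: le_trans.
- exact: le_total.
- exact: le0m.
- by move=> a b c; rewrite lemc_add2l.
Qed.

Lemma init_mon_deglex (K : fieldType) (N : nat) (p : {mpoly K[N]}) :
  p != 0 -> init_mon (fun a b => (a <= b)%O) p = mlead p.
Proof.
move=> p0; have [pin pmax] := init_monP (deglex_monomial_order N) p0.
by apply/le_anti; rewrite msupp_le_mlead //= pmax // mlead_supp.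
Qed.

Lemma ideal_span_sub (R : comNzRingType) (A B : R -> Prop) :
  (forall a, A a -> ideal_span B a) ->
  forall q, ideal_span A q -> ideal_span B q.
Proof.
move=> AB q [k [c [a [Aa ->]]]]; apply: ideal_span_sum => i.
exact/ideal_spanM/AB.
Qed.

(** Dickson's lemma, by induction on the number k of coordinates compared.  Let
    s dominate P in the first k coordinates.  A member of P whose next
    coordinate is at least all those of s is dominated by s in that coordinate
    as well; the others lie in the finitely many slices where this coordinate
    is a small constant, and the induction hypothesis applies to each slice. *)
Lemma dickson_coords (N k : nat) (P : 'X_{1..N} -> Prop) :
  exists s : seq 'X_{1..N}, (forall b, b \in s -> P b) /\
    forall a, P a ->
      exists2 b, b \in s & forall i : 'I_N, (i < k)%N -> (b i <= a i)%N.
Proof.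
elim: k P => [|k IHk] P.
  have [[a Pa]|noP] := classic (exists a, P a).
    exists [:: a]; split=> [b|b _]; first by rewrite inE => /eqP->.
    by exists a; rewrite ?mem_head.
  by exists [::]; split=> // a Pa; case: noP; exists a.
have [s [sP sdom]] := IHk P.
have [kN|Nk] := ltnP k N; last first.
  exists s; split=> // a /sdom[b bs ble]; exists b => // i _.
  by apply: ble; apply: leq_trans (ltn_ord i) Nk.
pose ik := Ordinal kN.
have [r [rP rdom]] : exists r : seq 'X_{1..N}, (forall b, b \in r -> P b) /\
    forall a, P a -> (a ik < \max_(b <- s) b ik)%N ->
      exists2 b, b \in r & forall i : 'I_N, (i < k.+1)%N -> (b i <= a i)%N.
  elim: (\max_(b <- s) b ik)%N => [|x [r [rP rdom]]]; first by exists [::].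
  have [t [tP tdom]] := IHk (fun a => P a /\ a ik = x).
  exists (r ++ t); split=> [b|a Pa].
    by rewrite mem_cat => /orP[/rP|/tP[]].
  rewrite ltnS leq_eqVlt => /predU1P[ax|ax]; last first.
    by have [b br ble] := rdom a Pa ax; exists b; rewrite // mem_cat br.
  have [b bt ble] := tdom a (conj Pa ax).
  exists b => [|i]; first by rewrite mem_cat bt orbT.
  rewrite ltnS leq_eqVlt => /predU1P[ik_eq|]; last exact: ble.
  have -> : i = ik by apply: val_inj.
  by have [_ ->] := tP b bt; rewrite ax.
exists (s ++ r); split=> [b|a Pa].
  by rewrite mem_cat => /orP[/sP|/rP].
have [large|small] := leqP (\max_(b <- s) b ik)%N (a ik); last first.
  by have [b br ble] := rdom a Pa small; exists b; rewrite // mem_cat br orbT.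
have [b bs ble] := sdom a Pa; exists b => [|i]; first by rewrite mem_cat bs.
rewrite ltnS leq_eqVlt => /predU1P[ik_eq|]; last exact: ble.
have -> : i = ik by apply: val_inj.
by apply: leq_trans large; apply: leq_bigmax_seq.
Qed.

Lemma finite_antichain (N : nat) (P : 'X_{1..N} -> Prop) :
  (forall a b, P a -> P b -> (b <= a)%MM -> b = a) ->
  exists s : seq 'X_{1..N}, forall a, a \in s <-> P a.
Proof.
move=> anti; have [s [sP sdom]] := dickson_coords N P.
exists s => a; split=> [/sP//|Pa]; have [b bs ble] := sdom a Pa.
rewrite -(anti a b Pa (sP b bs)) //.
by apply/mnm_lepP => i; apply: ble.
Qed.

(** * Reduced Groebner bases of toric ideals *)

Section Fibres.
Variables (N : nat) (T : eqType) (W : 'X_{1..N} -> T).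

(** The least monomial with the weight of a.  It has degree at most that of a,
    so the search can be confined to a finite type. *)
Definition fibre_min (a : 'X_{1..N}) : 'X_{1..N} :=
  [arg min_(b < BMultinom (ltnSn (mdeg a)) | W (bmnm b) == W a) bmnm b]%O.

Lemma fibre_min_weight a : W (fibre_min a) = W a.
Proof.
by rewrite /fibre_min; case: Order.TotalTheory.arg_minP => //= b /eqP.
Qed.

Lemma fibre_min_le a b : W b = W a -> (fibre_min a <= b)%O.
Proof.
move=> Wba; rewrite /fibre_min; case: Order.TotalTheory.arg_minP => //=.
move=> c _ cmin.
have [ab|ba] := ltnP (mdeg a) (mdeg b).
  apply: ltW; apply: lt_mdeg_ltmc; apply: leq_trans ab.
  by case: c {cmin}.
have bP : (mdeg b < (mdeg a).+1)%N by [].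
by apply: (cmin (BMultinom bP)); rewrite /= Wba.
Qed.

Lemma fibre_min_eq a b : W a = W b -> fibre_min a = fibre_min b.
Proof.
by move=> Wab; apply/le_anti; rewrite !fibre_min_le // fibre_min_weight.
Qed.

Lemma fibre_min_idem a : fibre_min (fibre_min a) = fibre_min a.
Proof. exact/fibre_min_eq/fibre_min_weight. Qed.

Lemma fibre_min_lt a : fibre_min a != a -> (fibre_min a < a)%O.
Proof. by move=> na; rewrite lt_neqAle na fibre_min_le. Qed.

Hypothesis WD : forall a b c, (W (a + c)%MM == W (b + c)%MM) = (W a == W b).

(** Multiplication by a monomial maps fibres into fibres and preserves the
    order, so a factor of the least element of a fibre is least in its own. *)
Lemma standard_factor a b : (b <= a)%MM -> fibre_min a = a -> fibre_min b = b.
Proof.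
move=> /submK => <- std; apply/le_anti; rewrite fibre_min_le //=.
rewrite -(lemc_add2r (a - b)%MM) -{1}std; apply: fibre_min_le.
by apply/eqP; rewrite ![((a - b) + _)%MM]addmC WD fibre_min_weight.
Qed.

Definition min_nonstd (a : 'X_{1..N}) : Prop :=
  fibre_min a != a /\ forall b, (b <= a)%MM -> fibre_min b != b -> b = a.

Lemma min_nonstd_below a :
  fibre_min a != a -> exists2 b, min_nonstd b & (b <= a)%MM.
Proof.
have [k] := ubnP (mdeg a); elim: k a => // k IHk a adeg na.
have [[b [ba nb nab]]|nob] :=
    classic (exists b, [/\ (b <= a)%MM, fibre_min b != b & b <> a]).
  have [|c cmin cb] := IHk b _ nb; last first.
    by exists c => //; apply: lepm_trans cb ba.
  rewrite -(submK ba) mdegD ltnS in adeg; apply: leq_trans adeg.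
  rewrite -add1n leq_add2r lt0n mdeg_eq0.
  by apply/eqP => ab0; apply: nab; rewrite -(submK ba) ab0 add0m.
exists a; last exact: lepm_refl.
split=> // b ba nb; apply: NNPP => nab; apply: nob; by exists b.
Qed.

(** A common variable of a and of the least element of its fibre could be
    cancelled, leaving a smaller nonstandard monomial. *)
Lemma min_nonstd_disjoint a i :
  min_nonstd a -> (a i == 0%N) || (fibre_min a i == 0%N).
Proof.
move=> [na amin]; apply/norP; rewrite -!lep1mP => -[ia inf].
have Wsub : W (fibre_min a - U_(i))%MM = W (a - U_(i))%MM.
  by apply/eqP; rewrite -(WD _ _ U_(i)%MM) !submK // fibre_min_weight.
have lt : ((fibre_min a - U_(i))%MM < (a - U_(i))%MM)%O.
  by rewrite -(ltmc_add2l _ _ U_(i)%MM) !submK // fibre_min_lt.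
have ns : fibre_min (a - U_(i)) != (a - U_(i))%MM.
  by apply/negP => /eqP std; have := fibre_min_le Wsub; rewrite std leNgt lt.
have := amin _ (lem_subr a U_(i)%MM) ns.
move/mnmP/(_ i)/eqP; rewrite mnmBE mnm1E eqxx eqn_leq => /andP[_].
by rewrite leqNgt ltn_subrL andTb lt0n -lep1mP ia.
Qed.

(** If a' were standard, it would be the least element of its fibre; so is b',
    as a factor of a standard monomial, hence a' = b'. *)
Lemma min_nonstd_primitive a a' b' :
  min_nonstd a -> (a' <= a)%MM -> (b' <= fibre_min a)%MM -> W a' = W b' ->
  a' != b' -> a' = a.
Proof.
move=> [na amin] aa bb Wab neq; apply: amin => //.
apply/eqP => std; case/negP: neq; apply/eqP.
rewrite -std (fibre_min_eq Wab).
by apply: standard_factor bb (fibre_min_idem a).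
Qed.

Section Ideal.
Variables (K : fieldType) (J : {mpoly K[N]} -> Prop).
Hypothesis J_binomial :
  forall a b, W a = W b -> J ('X_[a] - 'X_[b]).
Hypothesis J_fibre :
  forall p a, J p -> \sum_(c <- msupp p | W c == W a) p@_c = 0.

(** The leading monomial cannot be alone in its fibre, since the coefficients
    of p over that fibre add up to 0. *)
Lemma mlead_nonstd p : J p -> p != 0 -> fibre_min (mlead p) != mlead p.
Proof.
move=> Jp p0; apply/eqP => std.
have := J_fibre (mlead p) Jp.
rewrite big_mkcond (bigD1_seq (mlead p)) ?mlead_supp ?msupp_uniq //= eqxx.
rewrite big1_seq ?addr0; first by move/eqP; rewrite mleadc_eq0 (negPf p0).
move=> c /andP[neq cin]; case: eqP => // Wc; case/eqP: neq; apply/le_anti.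
by rewrite msupp_le_mlead //= -std fibre_min_le.
Qed.

Lemma mlead_binomial a : fibre_min a != a ->
  ('X_[a] - 'X_[fibre_min a] : {mpoly K[N]}) != 0 /\
  mlead ('X_[a] - 'X_[fibre_min a] : {mpoly K[N]}) = a.
Proof.
move=> na; have coef : ('X_[a] - 'X_[fibre_min a] : {mpoly K[N]})@_a = 1.
  by rewrite mcoeffB !mcoeffX eqxx (negPf na) subr0.
split.
  apply/negP => /eqP f0; move: coef; rewrite f0 mcoeff0.
  by move/eqP; rewrite eq_sym oner_eq0.
apply/le_anti/andP; split; last first.
  by apply: msupp_le_mlead; rewrite mcoeff_msupp coef oner_eq0.
apply: le_trans (mleadB_le _ _) _; rewrite !mleadXm leUx lexx /=.
exact: fibre_min_le.
Qed.

Lemma toric_reduced_groebner_basis :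
  exists s : seq 'X_{1..N}, (forall a, a \in s -> min_nonstd a) /\
    reduced_groebner_basis (fun a b => (a <= b)%O) J
      [seq 'X_[a] - 'X_[fibre_min a] | a <- s].
Proof.
have [|s sE] := @finite_antichain N min_nonstd.
  by move=> a b [_ amin] [nb _] ba; apply: amin.
have smin a : a \in s -> min_nonstd a by move/sE.
have in_mon a : a \in s ->
    init_mon (fun a b => (a <= b)%O)
      ('X_[a] - 'X_[fibre_min a] : {mpoly K[N]}) = a.
  move=> /smin[na _]; have [f0 fa] := mlead_binomial na.
  by rewrite init_mon_deglex.
exists s; split=> //; split.
- split=> [f /mapP[a as_ ->]|q].
    have [na _] := smin a as_; have [f0 _] := mlead_binomial na.
    by split=> //; apply: J_binomial; rewrite fibre_min_weight.
  split; apply: ideal_span_sub => r [p [Jp p0 ->]]; last first.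
    apply: ideal_span_gen; exists p; split=> //.
    have /mapP[a as_ ->] := Jp; apply: J_binomial; by rewrite fibre_min_weight.
  rewrite init_mon_deglex //.
  have [b bmin ble] := min_nonstd_below (mlead_nonstd Jp p0).
  have bs : b \in s by apply/sE.
  rewrite -(submK ble) mpolyXD; apply: ideal_spanM; apply: ideal_span_gen.
  exists ('X_[b] - 'X_[fibre_min b]); split; first by apply: map_f.
    by have [] := mlead_binomial bmin.1.
  by rewrite in_mon.
- move=> f /mapP[a as_ ->]; rewrite in_mon // mcoeffB !mcoeffX eqxx.
  by have [/negPf-> _] := smin a as_; rewrite subr0.
move=> f g /mapP[a as_ ->] /mapP[b bs ->] fg c cin; rewrite in_mon //.
have [na amin] := smin a as_; have [nb bmin] := smin b bs.
apply/negP => ac.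
have := msuppB_le cin; rewrite mem_cat !msuppX !inE.
case/orP => /eqP cE; rewrite {}cE in ac.
  by case/negP: fg; rewrite (bmin a ac na).
by case/eqP: na; apply: standard_factor ac (fibre_min_idem b).
Qed.

End Ideal.
End Fibres.

(** * Alternating paths *)

Lemma mdeg_gt0P (n : nat) (u : 'X_{1..n}) :
  reflect (exists j, (U_(j) <= u)%MM) (0 < mdeg u)%N.
Proof.
rewrite lt0n mdeg_eq0; apply: (iffP idP) => [|[j]].
  move=> u0; have [/existsP[j uj]|/existsPn no] := boolP [exists j, u j != 0%N].
    by exists j; rewrite lep1mP.
  case/eqP: u0; apply/mnmP => j; rewrite mnm0E; apply/eqP.
  by rewrite -[_ == _]negbK no.
by rewrite lep1mP; apply: contraNneq => ->; rewrite mnm0E.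
Qed.

Lemma lepm_add2 (n : nat) (a b c d : 'X_{1..n}) :
  (a <= b)%MM -> (c <= d)%MM -> (a + c <= b + d)%MM.
Proof.
move=> /mnm_lepP ab /mnm_lepP cd; apply/mnm_lepP => i.
by rewrite !mnmDE leq_add.
Qed.

Lemma addmACA (n : nat) (a b c d : 'X_{1..n}) :
  (a + b + (c + d) = a + c + (b + d))%MM.
Proof. by apply/mnmP => i; rewrite !mnmDE addnACA. Qed.

Section AlternatingPaths.
Variables (n m : nat) (e : 'I_m -> {set 'I_n}).

(** The exponent of the product of the edges of a, as a monomial in the
    vertices. *)
Definition incidence (a : 'X_{1..m}) : 'X_{1..n} :=
  [multinom (\sum_(i < m) a i * (j \in e i))%N | j < n].

Lemma incidenceD a b : incidence (a + b) = (incidence a + incidence b)%MM.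
Proof.
apply/mnmP => j; rewrite mnmDE !mnmE -big_split /=.
by apply: eq_bigr => i _; rewrite mnmDE mulnDl.
Qed.

Lemma incidence0 : incidence 0 = 0%MM.
Proof.
by apply/mnmP => j; rewrite !mnmE big1 // => i _; rewrite mnm0E mul0n.
Qed.

Lemma incidenceU i j : incidence U_(i) j = (j \in e i).
Proof.
rewrite mnmE (bigD1 i) //= mnm1E eqxx mul1n big1 ?addn0 // => k ki.
by rewrite mnm1E eq_sym (negPf ki).
Qed.

Hypothesis e_edge : forall i, #|e i| = 2.

Lemma edge_other_end i q : q \in e i ->
  exists r, incidence U_(i) = (U_(q) + U_(r))%MM.
Proof.
move=> qe; have /cards1P[r er] : #|e i :\ q| == 1%N.
  by have := cardsD1 q (e i); rewrite qe e_edge add1n => -[<-].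
exists r; apply/mnmP => j; rewrite incidenceU mnmDE !mnm1E -(setD1K qe) er.
have rq : r != q by have := set11 r; rewrite -er in_setD1 => /andP[].
rewrite !inE ![_ == j]eq_sym; case: (eqVneq j q) => [->|//].
by rewrite eq_sym (negPf rq).
Qed.

Lemma mdeg_incidence a : mdeg (incidence a) = (mdeg a * 2)%N.
Proof.
rewrite !mdegE.
rewrite (eq_bigr (fun j => \sum_(i < m) a i * (j \in e i))%N); last first.
  by move=> j _; rewrite mnmE.
rewrite exchange_big big_distrl /=; apply: eq_bigr => i _.
by rewrite -big_distrr -big_mkcond /= sum1_card e_edge.
Qed.

(** The invariant of an alternating path that has just arrived at q: all
    vertices are balanced except q, where (u, b) has one incidence more than
    (v, a).  The path either ends at q with a half-edge of u, or leaves q by an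
    edge of b; once that edge is removed, (v, a) has one incidence more than
    (u, b) at its other end, so the hypothesis recurs with the two pairs
    exchanged.  The condition on degrees says that the remaining path ends in
    exactly one half-edge, of either colour. *)
Lemma alternating_path u v a b q :
  (u + incidence b = v + incidence a + U_(q))%MM ->
  exists u' v' a' b', [/\ (u' <= u)%MM, (v' <= v)%MM, (a' <= a)%MM, (b' <= b)%MM
    & (u' + incidence b' = v' + incidence a' + U_(q))%MM
      /\ (mdeg u' + mdeg v')%N = 1%N].
Proof.
have [k] := ubnP (mdeg a + mdeg b).
elim: k u v a b q => // k IHk u v a b q ltk bal.
(* The path ends here if u has a half-edge at q. *)
have [uq|nuq] := boolP (U_(q) <= u)%MM.
  exists U_(q)%MM, 0%MM, 0%MM, 0%MM; split=> //.
  1-3: by apply/mnm_lepP => i; rewrite mnm0E.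
  by rewrite incidence0 !addm0 !add0m mdeg1 mdeg0.
have [i bi qi] : exists2 i, (U_(i) <= b)%MM & q \in e i.
  move: nuq; rewrite lep1mP negbK => /eqP uq0.
  have : (0 < incidence b q)%N.
    move/mnmP/(_ q): bal; rewrite !mnmDE mnm1E eqxx uq0 add0n => ->.
    by rewrite addn1.
  rewrite mnmE lt0n sum_nat_eq0 => /forallPn[i]; rewrite /= muln_eq0 negb_or.
  by case/andP=> bi; rewrite eqb0 negbK => qi; exists i; rewrite ?lep1mP.
have [r er] := edge_other_end qi.
have bE := submK bi; set b0 := (b - U_(i))%MM in bE.
have bal0 : (v + incidence a = u + incidence b0 + U_(r))%MM.
  apply/eqP; rewrite -(eqm_add2r U_(q)%MM) -bal -bE incidenceD er.
  by rewrite !addmA; apply/eqP; rewrite -!addmA [(U_(q) + _)%MM]addmC.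
have lt0 : (mdeg b0 + mdeg a < k)%N.
  by move: ltk; rewrite -bE mdegD mdeg1 addn1 addnS ltnS addnC.
have [v' [u' [b' [a' [vv uu bb aa [bal' deg']]]]]] := IHk _ _ _ _ _ lt0 bal0.
exists u', v', a', (b' + U_(i))%MM; split=> //; last first.
  split; last by rewrite addnC.
  by rewrite bal' incidenceD er -!addmA [(U_(q) + _)%MM]addmC.
by rewrite -bE; apply: lepm_add2 => //; apply: lepm_refl.
Qed.

(** In the conclusion, u' consists of the initial half-edge of the path, plus
    its final one when both have the same colour. *)
Lemma alternating_path_from u v a b :
  (u + incidence b = v + incidence a)%MM -> (0 < mdeg u)%N ->
  exists u' v' a' b', [/\ (u' <= u)%MM, (v' <= v)%MM, (a' <= a)%MM, (b' <= b)%MM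
    & (u' + incidence b' = v' + incidence a')%MM /\
      ((mdeg u' = 1%N /\ mdeg v' = 1%N) \/ (mdeg u' = 2%N /\ mdeg v' = 0%N))].
Proof.
move=> bal /mdeg_gt0P[p pu].
have bal0 : (v + incidence a = (u - U_(p)) + incidence b + U_(p))%MM.
  by rewrite -bal -{1}(submK pu) -!addmA [(U_(p) + _)%MM]addmC.
have [v' [u' [b' [a' [vv uu bb aa [bal' deg']]]]]] := alternating_path bal0.
exists (u' + U_(p))%MM, v', a', b'; split=> //.
  by rewrite -(submK pu); apply: lepm_add2 => //; apply: lepm_refl.
split; first by rewrite bal' -!addmA [(U_(p) + _)%MM]addmC.
rewrite mdegD mdeg1; case: (mdeg v') deg' => [|[|k]] /=.
- by rewrite add0n => ->; right.
- by rewrite add1n => -[->]; left.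
- by [].
Qed.

(** A path with both ends in u uses one edge of a more than of b, which the
    equality of mdeg a' and mdeg b' forbids.  Its complement is still balanced
    and has half-edges in v, because mdeg u = mdeg v; a path starting at one of
    these either is good by itself or has both ends in v, and then the two
    paths together have the right degrees. *)
Lemma small_balanced_part u v a b :
  (u + incidence b = v + incidence a)%MM -> mdeg a = mdeg b -> (0 < mdeg u)%N ->
  exists u' v' a' b', [/\ (u' <= u)%MM, (v' <= v)%MM, (a' <= a)%MM, (b' <= b)%MM
    & [/\ (u' + incidence b' = v' + incidence a')%MM, mdeg a' = mdeg b'
        & (0 < mdeg u' <= 2)%N]].
Proof.
have deg_bal u' v' a' b' : (u' + incidence b' = v' + incidence a')%MM ->
    (mdeg u' + mdeg b' * 2 = mdeg v' + mdeg a' * 2)%N.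
  by move/(congr1 mdeg); rewrite !mdegD !mdeg_incidence.
move=> bal dab u_gt0.
have duv : mdeg u = mdeg v.
  by have /eqP := deg_bal _ _ _ _ bal; rewrite dab eqn_add2r => /eqP.
have [u1 [v1 [a1 [b1 [uu vv aa bb [bal1 deg1]]]]]] :=
  alternating_path_from bal u_gt0.
have dbal1 := deg_bal _ _ _ _ bal1.
case: deg1 => -[du1 dv1].
  exists u1, v1, a1, b1; split=> //; split=> //; rewrite ?du1 //.
  apply/eqP; rewrite -(eqn_pmul2r (ltn0Sn 1)); apply/eqP/(@addnI 1).
  by move: dbal1; rewrite du1 dv1.
have da1 : mdeg a1 = (mdeg b1).+1.
  apply/eqP; rewrite -(eqn_pmul2r (ltn0Sn 1)) mulSn; apply/eqP.
  by move: dbal1; rewrite du1 dv1.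
have bal2 : ((v - v1) + incidence (a - a1) = (u - u1) + incidence (b - b1))%MM.
  apply/eqP; rewrite -(eqm_add2r (u1 + incidence b1)%MM) {1}bal1.
  rewrite addmACA -incidenceD !submK // addmACA -incidenceD !submK //.
  by rewrite bal.
have v_gt0 : (0 < mdeg (v - v1))%N.
  by have := mdegD (v - v1) v1; rewrite submK // dv1 addn0 => <-; rewrite -duv.
have [v2 [u2 [b2 [a2 [vv2 uu2 bb2 aa2 [bal2' deg2]]]]]] :=
  alternating_path_from bal2 v_gt0.
have dbal2 := deg_bal _ _ _ _ bal2'.
have below k (x x1 x2 : 'X_{1..k}) :
    (x1 <= x)%MM -> (x2 <= x - x1)%MM -> (x2 + x1 <= x)%MM.
  move=> x1x x2x; rewrite -(submK x1x); apply: lepm_add2 => //.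
  exact: lepm_refl.
case: deg2 => -[dv2 du2].
  exists u2, v2, a2, b2; split.
  - by apply: lepm_trans uu2 (lem_subr _ _).
  - by apply: lepm_trans vv2 (lem_subr _ _).
  - by apply: lepm_trans aa2 (lem_subr _ _).
  - by apply: lepm_trans bb2 (lem_subr _ _).
  split; rewrite ?du2 //.
  apply/eqP; rewrite -(eqn_pmul2r (ltn0Sn 1)); apply/eqP/(@addnI 1).
  by move: dbal2; rewrite du2 dv2.
exists (u2 + u1)%MM, (v2 + v1)%MM, (a2 + a1)%MM, (b2 + b1)%MM.
split; try exact: below.
split.
- by rewrite !incidenceD addmACA -bal2' bal1 addmACA.
- apply/eqP; rewrite !mdegD da1 addnS -addSn eqn_add2r.
  rewrite -(eqn_pmul2r (ltn0Sn 1)) mulSn; apply/eqP.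
  by move: dbal2; rewrite du2 dv2.
by rewrite mdegD du1 du2.
Qed.

End AlternatingPaths.

(** * The defining ideal of the Rees algebra *)

Section Rees.
Variables (K : fieldType) (n m : nat) (e : 'I_m -> {set 'I_n}).

Definition xpart (c : 'X_{1..n + m}) : 'X_{1..n} :=
  [multinom c (lshift m j) | j < n].

Definition ypart (c : 'X_{1..n + m}) : 'X_{1..m} :=
  [multinom c (rshift n i) | i < m].

Definition xymon (u : 'X_{1..n}) (a : 'X_{1..m}) : 'X_{1..n + m} :=
  [multinom match split k with inl j => u j | inr i => a i end | k < n + m].

Lemma xpart_xymon u a : xpart (xymon u a) = u.
Proof. by apply/mnmP => j; rewrite !mnmE (unsplitK (inl j)). Qed.

Lemma ypart_xymon u a : ypart (xymon u a) = a.
Proof. by apply/mnmP => i; rewrite !mnmE (unsplitK (inr i)). Qed.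

Lemma xymon_le u a c :
  (u <= xpart c)%MM -> (a <= ypart c)%MM -> (xymon u a <= c)%MM.
Proof.
move=> /mnm_lepP uc /mnm_lepP ac; apply/mnm_lepP => k; rewrite mnmE.
case: (splitP k) => [j|i] kE.
  by have := uc j; rewrite mnmE; congr (_ <= c _)%N; apply: val_inj.
by have := ac i; rewrite mnmE; congr (_ <= c _)%N; apply: val_inj.
Qed.

Lemma xpartD c d : xpart (c + d) = (xpart c + xpart d)%MM.
Proof. by apply/mnmP => j; rewrite !mnmE. Qed.

Lemma ypartD c d : ypart (c + d) = (ypart c + ypart d)%MM.
Proof. by apply/mnmP => j; rewrite !mnmE. Qed.

(** The exponent of the generator attached to the edge e i; the truncated
    subtraction is exact because an edge contains each vertex at most once. *)
Definition comp_exp (i : 'I_m) : 'X_{1..n} :=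
  ([multinom 1%N | j < n] - [multinom (j \in e i : nat) | j < n])%MM.

Definition coincidence (a : 'X_{1..m}) : 'X_{1..n} :=
  (\sum_(i < m) comp_exp i *+ a i)%MM.

Lemma coincidenceK a :
  (coincidence a + incidence e a = [multinom mdeg a | j < n])%MM.
Proof.
apply/mnmP => j; rewrite mnmDE mnm_sumE !mnmE mdegE -big_split /=.
apply: eq_bigr => i _; rewrite mulmnE mnmBE !mnmE mulnC -mulnDr.
by case: (j \in e i); rewrite ?muln1.
Qed.

(** The exponent, in x and in t, of the image of a monomial of T. *)
Definition rees_exp (c : 'X_{1..n + m}) : 'X_{1..n} * nat :=
  ((xpart c + coincidence (ypart c))%MM, mdeg (ypart c)).

(** Each generator is x_1 ... x_n divided by an edge, so for equal t-degrees
    the powers of x_1 ... x_n cancel and the edges change sides. *)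
Lemma rees_exp_eq c d : rees_exp c = rees_exp d <->
  (xpart c + incidence e (ypart d) = xpart d + incidence e (ypart c))%MM
  /\ mdeg (ypart c) = mdeg (ypart d).
Proof.
have key : mdeg (ypart c) = mdeg (ypart d) ->
  (xpart c + coincidence (ypart c) == xpart d + coincidence (ypart d))%MM =
  (xpart c + incidence e (ypart d) == xpart d + incidence e (ypart c))%MM.
  move=> cd.
  rewrite -(eqm_add2r (incidence e (ypart c) + incidence e (ypart d))%MM).
  rewrite {1}[(incidence e (ypart c) + _)%MM]addmC.
  rewrite ![((_ + coincidence _) + _)%MM]addmACA.
  by rewrite !coincidenceK cd eqm_add2r.
split=> [[/eqP cd deg]|[/eqP cd deg]].
  by split=> //; apply/eqP; rewrite -key.
by rewrite /rees_exp deg; congr pair; apply/eqP; rewrite key.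
Qed.

Lemma rees_expD a b c :
  (rees_exp (a + c)%MM == rees_exp (b + c)%MM) = (rees_exp a == rees_exp b).
Proof.
have coD (x y : 'X_{1..m}) :
    (coincidence (x + y) = coincidence x + coincidence y)%MM.
  apply/mnmP => j; rewrite mnmDE !mnm_sumE -big_split /=.
  by apply: eq_bigr => i _; rewrite !mulmnE mnmDE mulnDr.
rewrite /rees_exp !xpartD !ypartD !coD !mdegD !(addmACA _ (xpart c)) !xpair_eqE.
by rewrite eqm_add2r eqn_add2r.
Qed.

Lemma rees_map_monomial c :
  rees_map e ('X_[c] : {mpoly K[n + m]}) =
  ('X_[(rees_exp c).1])%:P * 'X^((rees_exp c).2).
Proof.
rewrite /rees_map mmapX /mmap1 big_split_ord /=.
under eq_bigr do rewrite (unsplitK (inl _)).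
under [X in _ * X]eq_bigr do rewrite (unsplitK (inr _)) exprMn.
rewrite big_split /= mulrA prodrXr.
rewrite (eq_bigr (fun j => ('X_j ^+ xpart c j)%:P)); last first.
  by move=> j _; rewrite mnmE rmorphXn.
rewrite [X in _ * X * _](eq_bigr
  (fun i => ('X_[comp_exp i] ^+ ypart c i)%:P)); last first.
  by move=> i _; rewrite mnmE rmorphXn.
rewrite -!rmorph_prod -mpolyXE_id mprodXnE -rmorphM -mpolyXD /=.
congr (_ * 'X^_); rewrite mdegE; apply: eq_bigr => i _; by rewrite mnmE.
Qed.

Lemma rees_mapE (p : {mpoly K[n + m]}) :
  rees_map e p = \sum_(c <- msupp p)
     (p@_c *: 'X_[(rees_exp c).1])%:P * 'X^((rees_exp c).2).
Proof.
rewrite /rees_map /mmap; apply: eq_bigr => c _.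
have := rees_map_monomial c; rewrite /rees_map mmapX => ->.
by rewrite /= mulrA -rmorphM /= mul_mpolyC.
Qed.

Lemma rees_binomial c d : rees_exp c = rees_exp d ->
  rees_defining_ideal e ('X_[c] - 'X_[d] : {mpoly K[n + m]}).
Proof.
move=> cd; rewrite /rees_defining_ideal /rees_map raddfB /=.
have h := rees_map_monomial; rewrite /rees_map in h.
by rewrite !h cd subrr.
Qed.

Lemma rees_fibre (p : {mpoly K[n + m]}) a : rees_defining_ideal e p ->
  \sum_(c <- msupp p | rees_exp c == rees_exp a) p@_c = 0.
Proof.
rewrite /rees_defining_ideal rees_mapE; case: (rees_exp a) => w k.
move=> /(congr1 (mcoeff w \o coefp k)) /=.
rewrite coef0 mcoeff0 coef_sum raddf_sum /= => sum0.
rewrite -[RHS]sum0 big_mkcond; apply: eq_bigr => c _.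
rewrite coefCM coefXn (surjective_pairing (rees_exp c)) xpair_eqE.
rewrite [k == _]eq_sym /=.
case: (_ == k); last by rewrite andbF mulr0 mcoeff0.
by rewrite andbT mulr1 mcoeffZ mcoeffX; case: ifP; rewrite ?mulr1 ?mulr0.
Qed.

Lemma y_monomial k (a : 'X_{1..m}) : mdeg a = k ->
  exists i : 'I_k -> 'I_m,
    \prod_(j < m) yvar K n j ^+ a j = \prod_(l < k) yvar K n (i l).
Proof.
elim: k a => [|k IHk] a dega.
  have i (l : 'I_0) : 'I_m by case: l.
  exists i; rewrite big_ord0 big1 // => j _.
  by move/eqP: dega; rewrite mdeg_eq0 => /eqP->; rewrite mnm0E expr0.
have /mdeg_gt0P[i0 i0a] : (0 < mdeg a)%N by rewrite dega.
have [|i iE] := IHk (a - U_(i0))%MM.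
  have := mdegD (a - U_(i0)) U_(i0).
  by rewrite submK // dega mdeg1 addn1 => -[].
exists (fun l => if unlift ord0 l is Some l' then i l' else i0).
rewrite big_ord_recl unlift_none.
under [X in _ = _ * X]eq_bigr do rewrite liftK.
rewrite -iE -[LHS]/(mmap1 (@yvar K n m) a) -(submK i0a) commr_mmap1_M.
  by rewrite mmap1U mulrC submK.
by move=> ? ?; apply: mulrC.
Qed.

Lemma monomial_split c :
  'X_[c] = S_to_T m 'X_[K, xpart c] * \prod_(j < m) yvar K n j ^+ ypart c j.
Proof.
rewrite mpolyXE_id big_split_ord /S_to_T comp_mpolyX; congr (_ * _).
  by apply: eq_bigr => j _; rewrite tnth_mktuple mnmE.
by apply: eq_bigr => i _; rewrite mnmE.
Qed.

Hypothesis e_edge : forall i, #|e i| = 2.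

(** A balanced part of the pair (c, d) with x-degree 1 or 2 is a pair of
    distinct monomials in the same fibre, as c and d are coprime; by primitivity
    its first component is c. *)
Lemma min_nonstd_xdeg c :
  min_nonstd rees_exp c ->
  (mdeg (xpart c) <= 2)%N /\ (mdeg (xpart (fibre_min rees_exp c)) <= 2)%N.
Proof.
move=> cmin; set d := fibre_min rees_exp c.
have /rees_exp_eq[bal deg] : rees_exp c = rees_exp d.
  by rewrite fibre_min_weight.
have duv : mdeg (xpart c) = mdeg (xpart d).
  move/(congr1 mdeg): bal; rewrite !mdegD !mdeg_incidence // deg.
  by move/eqP; rewrite eqn_add2r => /eqP.
suff : (mdeg (xpart c) <= 2)%N by rewrite -duv.
have [->//|u_gt0] := posnP (mdeg (xpart c)).
have [u [v [a [b [uc vd ac bd [bal' deg' /andP[u0 u2]]]]]]] :=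
  small_balanced_part e_edge bal deg u_gt0.
suff <- : xymon u a = c by rewrite xpart_xymon.
apply: (min_nonstd_primitive rees_expD cmin (b' := xymon v b)).
- exact: xymon_le.
- exact: xymon_le.
- by apply/rees_exp_eq; rewrite !xpart_xymon !ypart_xymon.
apply/negP => /eqP /(congr1 xpart); rewrite !xpart_xymon => uv.
have /mdeg_gt0P[j ju] := u0.
(* u = v would make c and d share the variable x_j. *)
have := min_nonstd_disjoint rees_expD (lshift m j) cmin.
have := lepm_trans ju uc; rewrite lep1mP mnmE => /negPf->.
rewrite uv in ju; have := lepm_trans ju vd; by rewrite lep1mP mnmE => /negPf->.
Qed.

End Rees.

Theorem theorem1p1 (K : fieldType) (n m : nat) (g : rel 'I_n)
    (e : 'I_m -> {set 'I_n}) (g_simple : simple_graph g)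
    (e_inj : injective e) (e_edges : [set e i | i : 'I_m] = edge_set g) :
  exists le : rel 'X_{1..n + m}, monomial_order le /\
  exists B : seq {mpoly K[n + m]},
    reduced_groebner_basis le (rees_defining_ideal (K := K) e) B /\
    forall f, f \in B ->
      exists (u v : 'X_{1..n}) (k : nat) (i j : 'I_k -> 'I_m),
        [/\ (mdeg u <= 2)%N, (mdeg v <= 2)%N
          & f = S_to_T m 'X_[K, u] * \prod_(l < k) yvar K n (i l)
              - S_to_T m 'X_[K, v] * \prod_(l < k) yvar K n (j l)].
Proof.
have e_edge i : #|e i| = 2.
  have : e i \in edge_set g by rewrite -e_edges imset_f.
  case/imsetP => -[p q]; rewrite inE /= => gpq ->.
  rewrite cards2; case: eqVneq gpq => // ->.
  by rewrite (proj2 g_simple).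
exists (fun a b => (a <= b)%O); split; first exact: deglex_monomial_order.
have [s [smin sgb]] := toric_reduced_groebner_basis (rees_expD e)
  (@rees_binomial K n m e) (@rees_fibre K n m e).
exists [seq 'X_[c] - 'X_[fibre_min (rees_exp e) c] | c <- s]; split=> //.
move=> f /mapP[c cs ->]; set d := fibre_min _ c.
have [uc vd] := min_nonstd_xdeg e_edge (smin c cs).
have /rees_exp_eq[_ deg] : rees_exp e c = rees_exp e d.
  by rewrite fibre_min_weight.
have [i iE] := y_monomial K n (erefl (mdeg (ypart c))).
have [j jE] := y_monomial K n (esym deg).
exists (xpart c), (xpart d), (mdeg (ypart c)), i, j; split=> //.
by rewrite !monomial_split iE jE.
Qed.
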